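(* Let $q$ be any prime power. If $\Theta\in E_q^{(t)}$, then $$\mathcal{H}^{h_1}(K(\Theta))>0.$$ Moreover, if $E_q^{(t)}$ is non-empty, then $$\mathcal{H}^{h_1}(E_q^{(t)})=\infty.$$ In particular, if $E_q^{(t)}$ is non-empty, then $\dim_{\log}E_q^{(t)}\ge 1$ and $E_q^{(t)}$ has the cardinality of the continuum.
   Context: $\mathbb{F}_q$ is the field with $q$ elements and $\mathbb{F}_q((t^{-1}))$ the field of formal Laurent series in $t^{-1}$. For non-zero $\Gamma=\sum_{j\ge -j_0}c_jt^{-j}$ with $c_{-j_0}\ne0$, put $\deg\Gamma=j_0$, $|\Gamma|=q^{\deg\Gamma}$; also $|0|=0$. The fractional part is $\langle\Gamma\rangle=\sum_{j\ge1}c_jt^{-j}$. Let $\mathbb{I}_q=t^{-1}\mathbb{F}_q[[t^{-1}]]$, with the ultrametric $d(\Theta,\Phi)=|\Theta-\Phi|$. For non-zero $Q\in\mathbb{F}_q[t]$ let $v_t(Q)=\max\{k\ge0:t^k\mid Q\}$ and $|Q|_t=q^{-v_t(Q)}$. For $\Theta\in\mathbb{I}_q$ let $$m_t(\Theta)=\inf_{0\ne Q\in\mathbb{F}_q[t]}|Q|\,|Q|_t\,|\langle Q\Theta\rangle|,\qquad E_q^{(t)}=\{\Theta\in\mathbb{I}_q:m_t(\Theta)>0\}.$$ Let $T:\mathbb{I}_q\to\mathbb{I}_q$, $T\Theta=\langle t\Theta\rangle$, and $K(\Theta)=\overline{\{T^j\Theta:j\ge0\}}$ (closure in $\mathbb{I}_q$).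 For a gauge function $h$ (continuous non-decreasing $h:[0,\infty)\to[0,\infty)$ with $h(0)=0$ and $h(r)>0$ for $r>0$), a subset $E$ of a metric space and $\delta>0$, $\mathcal{H}^h_\delta(E)=\inf\{\sum_i h(\operatorname{diam}U_i): E\subseteq\bigcup_i U_i,\ \operatorname{diam}U_i\le\delta\}$, the infimum being over countable covers, and $\mathcal{H}^h(E)=\lim_{\delta\to0}\mathcal{H}^h_\delta(E)$. For $s>0$, $h_s$ is the gauge $h_s(r)=1/(\log(1/r))^s$ for $0<r<e^{-1}$, $h_s(0)=0$, extended away from zero in any continuous non-decreasing way. The logarithmic Hausdorff dimension is $\dim_{\log}E=\inf\{s>0:\mathcal{H}^{h_s}(E)=0\}$ (with $\inf\emptyset=+\infty$). *)

(* Defs.v *)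
From HB Require Import structures.
From mathcomp Require Import all_boot all_order all_algebra.
From mathcomp Require Import all_classical all_reals all_analysis.

Set Implicit Arguments.
Unset Strict Implicit.
Unset Printing Implicit Defensive.

Import Order.TTheory GRing.Theory Num.Theory.
Import numFieldNormedType.Exports.

Local Open Scope classical_set_scope.
Local Open Scope ring_scope.

(* The series \sum_j c_j t^-j is encoded by its coefficient function c; note
   that c j is the coefficient of t^-j, so that c vanishes for all j small
   enough. *)
Definition laurent_pred (F : finFieldType) : {pred (int -> F)} :=
  fun c => `[< exists N : int, forall j, j < N -> c j = 0 >].

Record laurent (F : finFieldType) := Laurent {
  lcoef :> int -> F ;
  lcoefP : lcoef \in @laurent_pred F }.

HB.instance Definition _ (F : finFieldType) := [isSub for @lcoef F].
HB.instance Definition _ (F : finFieldType) := [Choice of laurent F by <:].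

Fact laurent_zmod_closed (F : finFieldType) : zmod_closed (@laurent_pred F).
Proof.
split; first by apply/asboolP; exists 0.
move=> u v /asboolP[N Nu] /asboolP[M Mv]; apply/asboolP.
exists (Num.min N M) => j; rewrite lt_min => /andP[jN jM].
have -> : (u - v) j = u j - v j by [].
by rewrite Nu// Mv// subr0.
Qed.
HB.instance Definition _ (F : finFieldType) :=
  GRing.isZmodClosed.Build (int -> F) (@laurent_pred F) (laurent_zmod_closed F).
HB.instance Definition _ (F : finFieldType) :=
  [SubChoice_isSubZmodule of laurent F by <:].

Definition ldeg (F : finFieldType) (G : laurent F) : int :=
  xget 0 [set d | G (- d) != 0 /\ forall j, j < - d -> G j = 0].

Definition lnorm (R : realType) (F : finFieldType) (G : laurent F) : R :=
  if G == 0 then 0 else #|F|%:R ^ ldeg G.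

(* The product of Q = \sum_i Q_i t^i and \sum_j c_j t^-j: the coefficient of
   t^-j is \sum_i Q_i c_(i + j). *)
Definition pmul_coef (F : finFieldType) (Q : {poly F}) (G : laurent F) :
  int -> F := fun j => \sum_(i < size Q) Q`_i * G (i%:Z + j).

Fact pmul_subproof (F : finFieldType) (Q : {poly F}) (G : laurent F) :
  pmul_coef Q G \in @laurent_pred F.
Proof.
have /asboolP[N NG] := lcoefP G; apply/asboolP.
exists (N - (size Q)%:Z) => j jN; rewrite /pmul_coef big1// => i _.
rewrite NG ?mulr0// addrC -ltrBrDr (lt_le_trans jN)// lerD2l lerN2 lez_nat.
exact/ltnW/ltn_ord.
Qed.

Definition pmul (F : finFieldType) (Q : {poly F}) (G : laurent F) : laurent F :=
  Laurent (pmul_subproof Q G).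

(* R is the real field in which distances are measured; it is a parameter of
   the type because a metric space carries its field of distances. *)
Record Iq (R : realType) (F : finFieldType) := MkIq {
  Iq_val :> laurent F ;
  IqP : `[< forall j : int, j <= 0 -> Iq_val j = 0 >] }.

HB.instance Definition _ (R : realType) (F : finFieldType) :=
  [isSub for @Iq_val R F].
HB.instance Definition _ (R : realType) (F : finFieldType) :=
  [Choice of Iq R F by <:].

Definition frac_coef (F : finFieldType) (G : laurent F) : int -> F :=
  fun j => if 1 <= j then G j else 0.

Fact frac_subproof (F : finFieldType) (G : laurent F) :
  frac_coef G \in @laurent_pred F.
Proof.
apply/asboolP; exists 1 => j; rewrite ltNge => /negPf j1.
by rewrite /frac_coef j1.
Qed.

Fact frac_Iq_subproof (F : finFieldType) (G : laurent F) :
  `[< forall j : int, j <= 0 -> Laurent (frac_subproof G) j = 0 >].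
Proof.
apply/asboolP => j j0; rewrite /= /frac_coef ifF//; apply/negbTE.
by rewrite -ltNge (le_lt_trans j0).
Qed.

Definition frac (R : realType) (F : finFieldType) (G : laurent F) : Iq R F :=
  MkIq R (frac_Iq_subproof G).

Section metric.
Context {R : realType} {F : finFieldType}.
Implicit Types (G H : laurent F) (x y : Iq R F).

Let q1 : 1 < #|F|%:R :> R.
Proof. by rewrite ltr1n card_finNzRing_gt1. Qed.

Lemma ldegP G : G != 0 ->
  G (- ldeg G) != 0 /\ forall j, j < - ldeg G -> G j = 0.
Proof.
move=> G0; rewrite /ldeg; case: xgetP => [d _ //|none]; exfalso.
have /asboolP[N NG] := lcoefP G.
have low n : forall j, j < N + n%:Z -> G j = 0.
  elim: n => [j|n IH j]; first by rewrite addr0; exact: NG.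
  rewrite -addn1 PoszD addrA ltzD1 le_eqVlt => /orP[/eqP ->|]; last exact: IH.
  apply/eqP/negPn/negP => Gn; apply: (none (- (N + n%:Z))).
  by rewrite /= opprK.
move/eqP: G0; apply; apply/val_inj/funext => j /=.
have [jN|Nj] := ltP j N; first exact: NG.
apply: (low `|j - N|%N.+1); rewrite -addn1 PoszD gez0_abs ?subr_ge0//.
by rewrite addrA subrKC ltrDl.
Qed.

Lemma lnorm0 : lnorm R (0 : laurent F) = 0.
Proof. by rewrite /lnorm eqxx. Qed.

Lemma lnorm_gt0 G : G != 0 -> 0 < lnorm R G.
Proof. by move=> G0; rewrite /lnorm (negbTE G0) exprz_gt0// (lt_trans _ q1). Qed.

Lemma lnorm_ge0 G : 0 <= lnorm R G.
Proof. by have [->|/lnorm_gt0/ltW//] := eqVneq G 0; rewrite lnorm0. Qed.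

Lemma lnorm_le G (n : int) :
  lnorm R G <= #|F|%:R ^ n <-> (forall j, j < - n -> G j = 0).
Proof.
have [->|G0] := eqVneq G 0.
  by rewrite lnorm0 exprz_ge0.
rewrite /lnorm (negbTE G0) ler_eXz2l//; have [Gd Glt] := ldegP G0; split.
  by move=> dn j jn; apply: Glt; rewrite (lt_le_trans jn)// lerN2.
move=> Gn; rewrite leNgt; apply/negP => nd.
by move/eqP: Gd; apply; apply: Gn; rewrite ltrN2.
Qed.

Lemma lnormN G : lnorm R (- G) = lnorm R G.
Proof.
have le H : lnorm R (- H) <= lnorm R H.
  have [->|H0] := eqVneq H 0; first by rewrite oppr0.
  rewrite [leRHS]/lnorm (negbTE H0); apply/lnorm_le => j jH.
  have -> : (- H : laurent F) j = - H j by [].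
  by rewrite (ldegP H0).2// oppr0.
by apply/le_anti; rewrite le -{1}(opprK G) le.
Qed.

Lemma lnormD_max G H : lnorm R (G + H) <= Num.max (lnorm R G) (lnorm R H).
Proof.
suff le G' H' : lnorm R G' <= lnorm R H' -> lnorm R (G' + H') <= lnorm R H'.
  by case: (leP (lnorm R G)) => [GH|/ltW HG]; [exact: le|rewrite addrC; exact: le].
have [->|H0] := eqVneq H' 0; first by rewrite addr0.
rewrite [lnorm R H']/lnorm (negbTE H0) => /lnorm_le GH.
apply/lnorm_le => j jH.
have -> : (G' + H' : laurent F) j = G' j + H' j by [].
by rewrite GH// (ldegP H0).2// addr0.
Qed.

Definition Iq_dist x y : R := lnorm R (Iq_val x - Iq_val y).

Fact Iq_distxx x : Iq_dist x x = 0.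
Proof. by rewrite /Iq_dist subrr lnorm0. Qed.

Fact Iq_dist_positivity x y : Iq_dist x y = 0 -> x = y.
Proof.
move=> xy0; apply/val_inj/eqP; rewrite -subr_eq0; apply/negPn/negP => xy.
by have := lnorm_gt0 xy; rewrite [X in _ < X]xy0 ltxx.
Qed.

Fact Iq_dist_sym x y : Iq_dist x y = Iq_dist y x.
Proof. by rewrite /Iq_dist -lnormN opprB. Qed.

Fact Iq_dist_triangle y x z : Iq_dist x z <= Iq_dist x y + Iq_dist y z.
Proof.
rewrite /Iq_dist -(subrKA (Iq_val y)) (le_trans (lnormD_max _ _))//.
by rewrite ge_max lerDl lerDr !lnorm_ge0.
Qed.

HB.instance Definition _ := @isMetric.Build R (Iq R F) Iq_dist
  Iq_distxx Iq_dist_positivity Iq_dist_sym Iq_dist_triangle.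

End metric.

Definition pnorm (R : realType) (F : finFieldType) (Q : {poly F}) : R :=
  if Q == 0 then 0 else #|F|%:R ^+ (size Q).-1.

(* The maximum ranges over k < size Q, which loses nothing since 'X^k %| Q
   forces k <= deg Q when Q != 0. *)
Definition vt (F : finFieldType) (Q : {poly F}) : nat :=
  \max_(k < size Q | 'X^k %| Q) k.

Definition ptnorm (R : realType) (F : finFieldType) (Q : {poly F}) : R :=
  #|F|%:R ^- vt Q.

Definition mt (R : realType) (F : finFieldType) (Theta : Iq R F) : R :=
  inf [set pnorm R Q * ptnorm R Q * lnorm R (frac R (pmul Q Theta))
      | Q in [set Q : {poly F} | Q != 0]].

Definition Eqt (R : realType) (F : finFieldType) : set (Iq R F) :=
  [set Theta | 0 < mt Theta].

Definition Tmap (R : realType) (F : finFieldType) (Theta : Iq R F) : Iq R F :=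
  frac R (pmul 'X Theta).

Definition Korbit (R : realType) (F : finFieldType) (Theta : Iq R F) :
  set (Iq R F) := closure (range (fun j : nat => iter j (@Tmap R F) Theta)).

Definition gauge (R : realType) (h : R -> R) : Prop :=
  [/\ {within `[0, +oo[, continuous h},
      {in `[0, +oo[ &, {homo h : r r' / r <= r'}},
      h 0 = 0 &
      forall r, 0 < r -> 0 < h r].

(* 0 is added to the set of distances so that diam set0 = 0. *)
Definition diam (R : realType) (X : metricType R) (U : set X) : \bar R :=
  ereal_sup ([set (mdist x y)%:E | x in U & y in U] `|` [set 0%E]).

(* Finite covers are covers by sequences of sets that are eventually empty,
   and empty sets contribute h 0 = 0. *)
Definition Hdelta (R : realType) (X : metricType R) (h : R -> R) (E : set X)
    (delta : R) : \bar R :=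
  ereal_inf [set (\sum_(0 <= i <oo) (h (fine (diam (U i))))%:E)%E
    | U in [set U : nat -> set X |
        E `<=` \bigcup_i U i /\ forall i, (diam (U i) <= delta%:E)%E]].

Definition Hmeasure (R : realType) (X : metricType R) (h : R -> R)
    (E : set X) : \bar R :=
  lim (Hdelta h E delta @[delta --> 0^'+]).

Definition log_gauge (R : realType) (s : R) (h : R -> R) : Prop :=
  gauge h /\ forall r, 0 < r < expR (-1) -> h r = (ln r^-1 `^ s)^-1.

(* h s plays the role of h_s, whose values away from 0 are a free choice. *)
Definition dim_log (R : realType) (X : metricType R) (h : R -> R -> R)
    (E : set X) : \bar R :=
  ereal_inf [set s%:E | s in [set s : R | 0 < s /\ Hmeasure (h s) E = 0%E]].

(* Main.v *)
Require Import Defs.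
From mathcomp Require Import all_boot all_order all_algebra.
From mathcomp Require Import all_classical all_reals all_analysis.
From mathcomp Require Import zify lra.
Import Order.TTheory GRing.Theory Num.Theory.
Local Open Scope classical_set_scope.
Local Open Scope ring_scope.
Set Implicit Arguments.
Unset Strict Implicit.
Unset Printing Implicit Defensive.

(** Identify Theta with its digit sequence c, so that multiplication by t
    followed by the fractional part is the shift.  Factoring t-powers out of Q
    shows that m_t(Theta) > 0 means: for some l, no window of c of length
    2 n + l + O(1) satisfies a non-trivial linear recurrence of order at most n
    ([Eqt_recurrence_free], [recurrence_free_Eqt]).

    Periodicity is a recurrence (take N = t^d - 1).  So if the same word of
    length n occurs in c at two positions, these are at least n - l apart
    ([recurrence_free_gap]), and every word of length n has frequency at most
    1 / (n - l) in c.  If K(Theta) is covered by cylinders of lengths n_i, then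
    by compactness finitely many of them contain all shifts of Theta, and
    adding up frequencies gives the sum of 1 / (n_i - l) at least 1.  As
    h_1 (q^-n) = 1 / (n log q), this bounds the h_1-content of K(Theta) from
    below.  The same count, made for all m-letter prefixes at once, bounds the
    content of T^-m K(Theta) below by a constant times q^m, the constant not
    depending on m ([Hdelta_Tpreimage_ge]).  Prefixes do not destroy the absence
    of recurrences, so T^-m K(Theta) lies in E_q^(t); letting m grow makes the
    measure of E_q^(t) infinite.  For s < 1 the gauge h_s dominates h_1 near 0,
    which gives the dimension.

    Countable sets have measure 0, hence K(Theta) is an uncountable closed set
    of sequences and contains a copy of the Cantor space; conversely digits
    embed E_q^(t) into the sequences over a finite alphabet. *)

(** * Sequences without short linear recurrences *)

(** The sum is the coefficient of t^-(j+1) in N T^k c, so this is a lower bound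
    |N| |<N T^k c>| >= q^-(l + 1), uniform in N and k. *)
Definition recurrence_free (F : finFieldType) (l : nat) (c : nat -> F) : Prop :=
  forall (N : {poly F}) (k : nat), N != 0 ->
    exists2 j, (j < size N + l)%N &
      \sum_(i < size N) N`_i * c (k + i + j)%N != 0.

Lemma sum_XnsubC (F : finFieldType) (d : nat) (f : nat -> F) : (0 < d)%N ->
  \sum_(i < size ('X^d - 1 : {poly F})) ('X^d - 1 : {poly F})`_i * f i
  = f d - f 0%N.
Proof.
case: d => // d _; rewrite -[1]/(1%:P) size_XnsubC//.
rewrite big_ord_recr big_ord_recl/= !coefB !coefXn !coefC !eqxx/=.
rewrite big1 => [|i _]; first by rewrite subr0 sub0r mulN1r mul1r addr0 addrC.
by rewrite coefB coefXn coefC/= /bump/= add1n eqSS (ltn_eqF (ltn_ord i)) subr0 mul0r.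
Qed.

(** A word repeated at distance d makes its window satisfy the recurrence
    with polynomial t^d - 1; if d is small compared with n, this window is too
    long for that. *)
Lemma recurrence_free_gap (F : finFieldType) (l : nat) (c : nat -> F)
    (n k d : nat) :
  recurrence_free l c -> (0 < d)%N ->
  (forall i, (i < n)%N -> c (k + i)%N = c (k + d + i)%N) -> (n <= d + l)%N.
Proof.
move=> cl d0 per.
have N0 : 'X^d - 1 != 0 :> {poly F}.
  by rewrite -size_poly_eq0 -[1]/(1%:P) size_XnsubC.
have [j] := cl _ k N0.
rewrite (sum_XnsubC (fun i => c (k + i + j)%N)) // -[1]/(1%:P) size_XnsubC// => jd.
rewrite leqNgt; apply: contra_neqN => nd.
by rewrite addn0 (per j) ?subrr//; apply: leq_trans jd nd.
Qed.

(** Compactness of T^nat for the finite set T: along an ultrafilter on the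
    indices M, each coordinate is eventually constant. *)
Lemma seq_cluster (T : finType) (y : nat -> nat -> T) :
  exists z : nat -> T, forall n i0, exists2 M, (i0 <= M)%N &
    forall j, (j < n)%N -> y M j = z j.
Proof.
have [U [UU ooU]] := ultraFilterLemma (_ : ProperFilter (\oo : set_system nat)).
have lim j : exists a, U [set M | y M j = a].
  apply: contrapT => /forallNP noa.
  have noU (s : seq T) : U [set M | y M j \notin s].
    elim: s => [|a s IH]; first by apply: filterS filterT.
    have [/noa//|aU] := in_ultra_setVsetC [set M | y M j = a] UU.
    apply: filterS2 IH aU => M /= ys ya; rewrite inE negb_or ys andbT.
    exact/eqP.
  by case/filter_ex: (noU (enum T)) => M /=; rewrite mem_enum.
have [z zU] := choice lim; exists z => n i0.
have : U ([set M | (i0 <= M)%N] `&` [set M | forall j, (j < n)%N -> y M j = z j]).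
  apply: filterI; first by apply: ooU; exists i0.
  elim: n => [|n IH]; first by apply: filterS filterT => M _ j.
  apply: filterS2 IH (zU n) => M /= lt eq j; rewrite ltnS leq_eqVlt.
  by case/predU1P => [->//|/lt].
by case/filter_ex => M [? ?]; exists M.
Qed.

(** Read B i w k as: the i-th covering set contains the point with prefix w and
    then the k-th shift.  For a fixed i, such pairs (w, k) share w and have the
    k's spaced by g i, so they have frequency at most 1 / g i; all pairs
    together have frequency #|T|. *)
Lemma separated_cover_count (R : realType) (T : finType) (M : nat)
    (g : nat -> nat) (B : nat -> T -> nat -> bool) :
  (forall w k, exists2 i, (i < M)%N & B i w k) ->
  (forall i, 0 < g i)%N ->
  (forall i w k w' k', B i w k -> B i w' k' ->
     w = w' /\ ((k < k')%N -> (k + g i <= k')%N)) ->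
  #|T|%:R <= \sum_(i < M) (g i)%:R^-1 :> R.
Proof.
move=> cov g0 sep; set S : R := \sum_(i < M) _.
(* Distinct k's spaced by g i lie in distinct blocks of length g i. *)
have countB i L : (#|[pred p : T * 'I_L | B i p.1 p.2]| <= (L %/ g i).+1)%N.
  have lt (p : T * 'I_L) : (p.2 %/ g i < (L %/ g i).+1)%N.
    by rewrite ltnS leq_div2r// ltnW.
  have inj : {in [pred p : T * 'I_L | B i p.1 p.2] &,
      injective (fun p => Ordinal (lt p))}.
    move=> [w k] [w' k']; rewrite !inE/= => Bw Bw' /(congr1 val)/= kk'.
    have [<- sk] := sep _ _ _ _ _ Bw Bw'; have [_ sk'] := sep _ _ _ _ _ Bw' Bw.
    have step (a b : nat) : (a + g i <= b)%N -> (a %/ g i < b %/ g i)%N.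
      by move=> /(leq_div2r (g i)); rewrite divnDr// divnn g0 addn1.
    congr (_, _); apply/val_inj.
    by case: (ltngtP k k') => [/sk/step|/sk'/step|//]; rewrite kk' ltnn.
  by rewrite -(card_in_imset inj) -[leqRHS]card_ord max_card.
have countL L : (#|T| * L <= \sum_(i < M) (L %/ g i).+1)%N.
  rewrite -{1}[L]card_ord -card_prod.
  rewrite -sum1_card.
  apply: (@leq_trans (\sum_(p : T * 'I_L) \sum_(i < M) B i p.1 p.2)).
    apply: leq_sum => -[w k] _; have [i iM Bi] := cov w k.
    by rewrite (bigD1 (Ordinal iM))//= Bi leq_addr.
  rewrite exchange_big; apply: leq_sum => i _.
  apply: leq_trans (countB i L).
  rewrite -sum1_card [leqRHS]big_mkcond; apply: leq_sum => p _.
  by rewrite inE; case: (B i p.1 p.2).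
have countR L : #|T|%:R * L.+1%:R <= S * L.+1%:R + M%:R :> R.
  apply: (@le_trans _ _ (\sum_(i < M) (L.+1 %/ g i).+1%:R)).
    by rewrite -natrM -natr_sum ler_nat.
  rewrite mulr_suml -[in M%:R](card_ord M) -sum1_card natr_sum -big_split/=.
  apply: ler_sum => i _; rewrite -natr1 lerD2r mulrC.
  by rewrite ler_pdivlMr ?ltr0n// -natrM ler_nat leq_divM.
(* Dividing by L.+1 and letting L grow removes the error term M. *)
rewrite leNgt; apply/negP => ST.
have e0 : 0 < #|T|%:R - S by rewrite subr_gt0.
have := archi_boundP (divr_ge0 (ler0n R M) (ltW e0)).
set L := Num.bound _; rewrite ltr_pdivrMr// => ML.
have := countR L; rewrite addrC -lerBlDr -mulrBl mulrC.
rewrite leNgt (lt_le_trans ML)// ler_wpM2r ?ler_nat//; exact: ltW.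
Qed.

(** * Digits of elements of I_q *)

Definition dig (R : realType) (F : finFieldType) (x : Iq R F) (i : nat) : F :=
  x i.+1%:Z.

Fact of_dig_subproof (F : finFieldType) (c : nat -> F) :
  (fun j : int => if j is Posz i.+1 then c i else 0) \in @laurent_pred F.
Proof. by apply/asboolP; exists 1 => -[[|j]|j]. Qed.

Fact of_dig_Iq_subproof (F : finFieldType) (c : nat -> F) :
  `[< forall j : int, j <= 0 -> Laurent (of_dig_subproof c) j = 0 >].
Proof. by apply/asboolP => -[[|j]|j]. Qed.

Definition of_dig (R : realType) (F : finFieldType) (c : nat -> F) : Iq R F :=
  MkIq R (of_dig_Iq_subproof c).

Lemma of_digK (R : realType) (F : finFieldType) (c : nat -> F) :
  dig (of_dig R c) = c.
Proof. exact/funext. Qed.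

Lemma Iq_low (R : realType) (F : finFieldType) (x : Iq R F) (j : int) :
  j <= 0 -> x j = 0.
Proof. by have /asboolP := IqP x; apply. Qed.

Lemma dig_inj (R : realType) (F : finFieldType) (x y : Iq R F) :
  dig x =1 dig y -> x = y.
Proof.
move=> xy; do 2!apply/val_inj; apply/funext => j /=.
have [j0|] := leP j 0; first by rewrite !Iq_low.
by case: j => [[|j]|j]// _; exact: xy.
Qed.

Lemma digK (R : realType) (F : finFieldType) (x : Iq R F) :
  of_dig R (dig x) = x.
Proof. by apply: dig_inj => i; rewrite of_digK. Qed.

Lemma lnorm_dig (R : realType) (F : finFieldType) (x : Iq R F) (n : nat) :
  lnorm R x <= #|F|%:R ^ (- n.+1%:Z) <-> forall i, (i < n)%N -> dig x i = 0.
Proof.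
rewrite lnorm_le opprK; split=> [x0 i ni|x0 j]; first by apply: x0; lia.
have [j0 _|] := leP j 0; first exact: Iq_low.
by case: j => [[|j]|j]// _ jn; apply: x0; lia.
Qed.

(** The digit of index i is the coefficient of t^-(i+1); agreement of n digits
    thus means distance at most q^-(n+1). *)
Lemma mdist_dig (R : realType) (F : finFieldType) (x y : Iq R F) (n : nat) :
  mdist x y <= #|F|%:R ^ (- n.+1%:Z) <->
  forall i, (i < n)%N -> dig x i = dig y i.
Proof.
have dE i : (Iq_val x - Iq_val y : laurent F) i = x i - y i by [].
rewrite [mdist x y]/(lnorm R (Iq_val x - Iq_val y)) lnorm_le opprK.
split=> [x0 i ni|x0 j].
  by apply/subr0_eq; rewrite /dig -dE; apply: x0; lia.
rewrite dE; have [j0 _|] := leP j 0; first by rewrite !Iq_low// subrr.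
case: j => [[|j]|j]// _ jn.
by have := x0 j; rewrite /dig => ->; rewrite ?subrr//; lia.
Qed.

Lemma dig_frac_pmul (R : realType) (F : finFieldType) (Q : {poly F})
    (x : Iq R F) (j : nat) :
  dig (Defs.frac R (pmul Q x)) j = \sum_(i < size Q) Q`_i * dig x (i + j)%N.
Proof.
rewrite /dig /= /frac_coef /= /pmul_coef; apply: eq_bigr => i _.
by rewrite -PoszD addnS.
Qed.

Lemma dig_Tmap (R : realType) (F : finFieldType) (x : Iq R F) (j : nat) :
  dig (Tmap x) j = dig x j.+1.
Proof.
rewrite dig_frac_pmul size_polyX !big_ord_recl big_ord0 !coefX /=.
by rewrite mul0r add0r mul1r addr0.
Qed.

Lemma dig_iter_Tmap (R : realType) (F : finFieldType) (x : Iq R F) (k j : nat) :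
  dig (iter k (@Tmap R F) x) j = dig x (k + j)%N.
Proof.
by elim: k j => //= k IH j; rewrite dig_Tmap IH addnS.
Qed.

Lemma card_gt1R (R : realType) (F : finFieldType) : 1 < #|F|%:R :> R.
Proof. by rewrite ltr1n card_finNzRing_gt1. Qed.

Lemma small_exprzN (R : realType) (F : finFieldType) (e : R) : 0 < e ->
  exists n0 : nat, forall n, (n0 <= n)%N -> #|F|%:R ^ (- n%:Z) < e.
Proof.
move=> e0; have q1 := card_gt1R R F.
have q0 : 0 < #|F|%:R :> R by apply: lt_trans q1.
exists (Num.bound e^-1) => n en.
rewrite -exprnN invf_plt ?posrE ?exprn_gt0//.
apply: lt_le_trans (_ : n%:R <= _).
  have e1 : 0 <= e^-1 by rewrite invr_ge0 ltW.
  by apply: lt_le_trans (archi_boundP e1) _; rewrite ler_nat.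
rewrite -natrX ler_nat; apply/ltnW/ltn_expl.
by rewrite card_finNzRing_gt1.
Qed.

Lemma KorbitP (R : realType) (F : finFieldType) (Theta x : Iq R F) :
  Korbit Theta x <->
  forall n, exists k, forall i, (i < n)%N -> dig x i = dig Theta (k + i)%N.
Proof.
split=> [clx n|apx B /nbhs_ballP[e/= e0 eB]].
  have q0 : 0 < #|F|%:R ^ (- n.+1%:Z) :> R.
    by rewrite exprz_gt0// (lt_trans _ (card_gt1R R F)).
  have [_ [[k _ <-] /ltW xk]] := clx _ (nbhsx_ballx x _ q0).
  by exists k => i ni; rewrite -dig_iter_Tmap; apply: (iffLR (mdist_dig _ _ _) xk).
have [n ne] := small_exprzN F e0; have [k xk] := apx n.
exists (iter k (@Tmap R F) Theta); split; first by exists k.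
apply: eB; apply: le_lt_trans (ne n.+1 _); last exact: leqnSn.
by apply/mdist_dig => i ni; rewrite dig_iter_Tmap xk.
Qed.

Lemma dvdp_Xn_vt (F : finFieldType) (Q : {poly F}) : 'X^(vt Q) %| Q.
Proof.
rewrite /vt; elim/big_ind: _ => //; first by rewrite expr0 dvd1p.
by move=> a b; case: (leqP a b).
Qed.

Lemma leq_vt (F : finFieldType) (Q : {poly F}) (k : nat) :
  Q != 0 -> 'X^k %| Q -> (k <= vt Q)%N.
Proof.
move=> Q0 kQ; have kS : (k < size Q)%N.
  by have := dvdp_leq Q0 kQ; rewrite size_polyXn.
exact: (@bigop.bigmax_sup _ (Ordinal kS)).
Qed.

Lemma dig_frac_mulXn (R : realType) (F : finFieldType) (N : {poly F}) (k : nat)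
    (x : Iq R F) (j : nat) : N != 0 ->
  dig (Defs.frac R (pmul (N * 'X^k) x)) j =
  \sum_(i < size N) N`_i * dig x (k + i + j)%N.
Proof.
move=> N0; rewrite dig_frac_pmul size_mulXn//.
rewrite big_split_ord/= big1 ?add0r => [|i _].
  by apply: eq_bigr => i _; rewrite coefMXn ltnNge leq_addr/= addKn.
by rewrite coefMXn ltn_ord mul0r.
Qed.

(** Test m_t(x) on Q = N t^k: the factor |Q|_t cancels the t^k in |Q|, whether
    or not t divides N. *)
Lemma Eqt_recurrence_free (R : realType) (F : finFieldType) (x : Iq R F) :
  Eqt x -> exists l, recurrence_free l (dig x).
Proof.
move=> x0; have [l lx] := small_exprzN F x0; exists l => N k N0.
apply: contrapT => none.
have q1 := card_gt1R R F; have q0 : 0 < #|F|%:R :> R by apply: lt_trans q1.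
have Q0 : N * 'X^k != 0 by rewrite mulf_neq0// -size_poly_eq0 size_polyXn.
have /lnorm_dig small : forall i, (i < size N + l)%N ->
    dig (Defs.frac R (pmul (N * 'X^k) x)) i = 0.
  move=> i ni; rewrite dig_frac_mulXn//; apply/eqP; apply: contra_notT none.
  by exists i.
have := lx _ (leqnSn l); apply/negP; rewrite -leNgt.
have lb : has_lbound [set pnorm R Q * ptnorm R Q * lnorm R (Defs.frac R (pmul Q x))
      | Q in [set Q : {poly F} | Q != 0]].
  exists 0 => _ [Q Q1 <-]; rewrite !mulr_ge0//.
  - by rewrite /pnorm (negbTE Q1) exprn_ge0// ltW.
  - by rewrite /ptnorm invr_ge0 exprn_ge0// ltW.
  - exact: lnorm_ge0.
apply: le_trans (ge_inf lb (_ : _ (_ * _))) _; first by exists (N * 'X^k).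
rewrite /pnorm (negbTE Q0) /ptnorm.
apply: le_trans (ler_wpM2l _ small) _.
  by rewrite mulr_ge0// ?invr_ge0 exprn_ge0// ltW.
rewrite size_mulXn// exprnN exprnP -!expfzDr ?gt_eqF// ler_eXz2l//.
have := leq_vt Q0 (dvdp_mull N (dvdpp _)); have := size_poly_gt0 N; rewrite N0.
lia.
Qed.

(** Conversely, every Q is N t^k with k = v_t(Q), and then |Q| |Q|_t = |N|. *)
Lemma recurrence_free_Eqt (R : realType) (F : finFieldType) (x : Iq R F) l :
  recurrence_free l (dig x) -> Eqt x.
Proof.
move=> xl.
have q1 := card_gt1R R F; have q0 : 0 < #|F|%:R :> R by apply: lt_trans q1.
have pos : 0 < #|F|%:R ^ (- l.+2%:Z) :> R by rewrite exprz_gt0.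
apply: lt_le_trans pos _; apply: lb_le_inf.
  by exists (pnorm R (1 : {poly F}) * ptnorm R (1 : {poly F}) *
    lnorm R (Defs.frac R (pmul 1 x))), 1 => //=; rewrite oner_neq0.
move=> _ [Q /= Q0 <-].
have [N QN] : exists N : {poly F}, Q = N * 'X^(vt Q).
  by have /dvdpP[N] := dvdp_Xn_vt Q; exists N.
have N0 : N != 0 by apply: contraNneq Q0 => N0; rewrite QN N0 mul0r.
have [j jN] := xl N (vt Q) N0; rewrite -dig_frac_mulXn// -QN => xj.
have big : #|F|%:R ^ (- (size N + l).+1%:Z) <= lnorm R (Defs.frac R (pmul Q x)).
  rewrite leNgt; apply: contraNN xj => /ltW/lnorm_dig x0.
  by rewrite x0.
rewrite /pnorm (negbTE Q0) /ptnorm.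
apply: le_trans (ler_wpM2l _ big).
  rewrite [in size Q]QN size_mulXn// exprnN exprnP -!expfzDr ?gt_eqF// ler_eXz2l//.
  have := size_poly_gt0 N; rewrite N0; lia.
by rewrite mulr_ge0// ?invr_ge0 exprn_ge0// ltW.
Qed.

(** * Content of the preimages of an orbit closure *)

Definition prefixed (F : finFieldType) (m : nat) (c : nat -> F)
    (w : m.-tuple F) (k j : nat) : F :=
  if (j < m)%N then nth 0 w j else c (k + (j - m))%N.

Lemma prefixed_tail (F : finFieldType) (m : nat) (c : nat -> F)
    (w : m.-tuple F) (k j : nat) : prefixed c w k (m + j) = c (k + j)%N.
Proof. by rewrite /prefixed ltnNge leq_addr/= addKn. Qed.

Definition Tpreimage (R : realType) (F : finFieldType) (m : nat)
    (Theta : Iq R F) : set (Iq R F) :=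
  [set x | Korbit Theta (iter m (@Tmap R F) x)].

(** A window of length r of x after its first m digits is a window of Theta.
    Hence the absence of recurrences passes from Theta to x, with l replaced by
    l + m to skip these m digits. *)
Lemma Tpreimage_Eqt (R : realType) (F : finFieldType) (m : nat)
    (Theta : Iq R F) : Eqt Theta -> Tpreimage m Theta `<=` @Eqt R F.
Proof.
move=> /Eqt_recurrence_free[l Tl] x /KorbitP xK.
apply: (@recurrence_free_Eqt _ _ _ (l + m)) => N k N0.
(* All digits that the recurrence N at position k looks at have index below
   this bound. *)
have [k' xk] := xK (k + (size N + (size N + l)))%N.
have [j jN nz] := Tl N (k' + k)%N N0; exists (m + j)%N; first by lia.
apply: contraNN nz => /eqP sx; apply/eqP.
rewrite -[RHS]sx; apply: eq_bigr => i _; congr (_ * _).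
have {}xk := xk (k + i + j)%N; rewrite dig_iter_Tmap in xk.
have -> : (k + i + (m + j) = m + (k + i + j))%N by lia.
by rewrite xk ?addnA//; have := ltn_ord i; lia.
Qed.

(** The prefixes can be read off the first m digits; the remaining n - m common
    digits are a word that occurs in c at both k and k'. *)
Lemma prefixed_agree (F : finFieldType) (m l n : nat) (c : nat -> F)
    (w w' : m.-tuple F) (k k' : nat) :
  recurrence_free l c -> (m <= n)%N ->
  (forall j, (j < n)%N -> prefixed c w k j = prefixed c w' k' j) ->
  w = w' /\ ((k < k')%N -> (k + (n - m - l) <= k')%N).
Proof.
move=> cl mn eq; split.
  apply/eq_from_tnth => j; rewrite !(tnth_nth 0).
  have := eq j; rewrite /prefixed ltn_ord; apply.
  exact: leq_trans (ltn_ord j) mn.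
move=> kk'; suff : (n - m <= k' - k + l)%N by lia.
apply: (recurrence_free_gap (k := k) cl); first by rewrite subn_gt0.
move=> i im; have := eq (m + i)%N; rewrite !prefixed_tail subnKC ?(ltnW kk')//.
by apply; lia.
Qed.

(** Each covering set is enlarged to the union of the cylinders of length n i
    around its points, which is open; a limit of points avoiding more and more
    of these open sets would lie in none of the U i. *)
Lemma Tpreimage_finite_cover (R : realType) (F : finFieldType) (m : nat)
    (Theta : Iq R F) (U : nat -> set (Iq R F)) (n : nat -> nat) :
  Tpreimage m Theta `<=` \bigcup_i U i ->
  exists M, forall (w : m.-tuple F) k, exists2 i, (i < M)%N &
    exists2 u, U i u &
      forall j, (j < n i)%N -> dig u j = prefixed (dig Theta) w k j.
Proof.
move=> cov; apply: contrapT => /forallNP none.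
have bad M : exists p : m.-tuple F * nat, forall i u, (i < M)%N -> U i u ->
    ~ forall j, (j < n i)%N -> dig u j = prefixed (dig Theta) p.1 p.2 j.
  apply: contrapT => /forallNP all; apply: (none M) => w k.
  apply: contrapT => nex; apply: (all (w, k)) => i u iM Uu eq; apply: nex.
  by exists i => //; exists u.
have [p pP] := choice bad.
have [z zP] := seq_cluster (fun M => prefixed (dig Theta) (p M).1 (p M).2).
have [i _ Ui] : (\bigcup_i U i) (of_dig R z).
  apply: cov; apply/KorbitP => r; have [M _ Mz] := zP (m + r)%N 0%N.
  exists (p M).2 => j jr; rewrite dig_iter_Tmap of_digK -Mz ?ltn_add2l//.
  exact: prefixed_tail.
have [M iM Mz] := zP (n i) i.+1.
by apply: (pP M i _ iM Ui) => j jn; rewrite of_digK Mz.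
Qed.

Lemma gauge_ge0 (R : realType) (h : R -> R) (r : R) :
  gauge h -> 0 <= r -> 0 <= h r.
Proof.
by move=> [_ _ h0 hpos]; rewrite le_eqVlt => /predU1P[<-|/hpos/ltW//]; rewrite h0.
Qed.

Lemma diam_ge0 (R : realType) (X : metricType R) (U : set X) :
  (0 <= diam U)%E.
Proof. by apply: ereal_sup_ubound; right. Qed.

Lemma diam_fin (R : realType) (X : metricType R) (U : set X) (d : R) :
  (diam U <= d%:E)%E -> diam U \is a fin_num.
Proof.
by move=> Ud; rewrite ge0_fin_numE ?diam_ge0//; apply: le_lt_trans Ud (ltry _).
Qed.

(** A set with two points has a longest common prefix, of length n say, and then
    its diameter is in fact q^-(n+1); the weaker bound suffices, since only the
    order of magnitude of n matters. *)
Lemma diam_agree (R : realType) (F : finFieldType) (U : set (Iq R F)) (d : R) :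
  (diam U <= d%:E)%E ->
  (forall x y, U x -> U y -> x = y) \/
  exists2 n : nat,
    (forall x y, U x -> U y -> forall j, (j < n)%N -> dig x j = dig y j) &
    #|F|%:R ^ (- n.+2%:Z) <= fine (diam U).
Proof.
move=> Ud.
pose P n := `[< exists x y, [/\ U x, U y & dig x n != dig y n] >].
have [ex|none] := pselect (exists n, P n); last first.
  left=> x y Ux Uy; apply: dig_inj => n; apply/eqP/negPn/negP => xy.
  by apply: none; exists n; apply/asboolP; exists x, y.
right; case: (ex_minnP ex) => n /asboolP[x [y [Ux Uy xy]]] nmin; exists n.
  move=> a b Ua Ub j jn; apply/eqP/negPn/negP => ab.
  have /nmin : P j by apply/asboolP; exists a, b.
  by rewrite leqNgt jn.
apply: (@le_trans _ _ (mdist x y)).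
  rewrite leNgt; apply: contraNN xy => /ltW/mdist_dig eq.
  by apply/eqP/eq.
rewrite -lee_fin fineK ?(diam_fin Ud)//; apply: ereal_sup_ubound.
by left; exists x => //; exists y.
Qed.

(** A covering set that fixes n digits catches a fraction at most about 1 / n of
    the shifts of Theta behind a given prefix, and costs h (q^-n) >= c / n; the
    fractions add up to at least the number of prefixes.  Only the scale d0
    depends on m. *)
Lemma Hdelta_Tpreimage_ge (R : realType) (F : finFieldType) (h : R -> R) (c : R)
    (n0 m : nat) (Theta : Iq R F) : gauge h -> 0 < c ->
  (forall n, (n0 <= n)%N -> c / n%:R <= h (#|F|%:R ^ (- n%:Z))) ->
  Eqt Theta ->
  exists2 d0 : R, 0 < d0 & forall d A, d <= d0 -> Tpreimage m Theta `<=` A ->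
    ((c / 2 * #|F|%:R ^+ m)%:E <= Hdelta h A d)%E.
Proof.
move=> gh c0 hlow /Eqt_recurrence_free[l Tl].
have q1 := card_gt1R R F; have q0 : 0 < #|F|%:R :> R by apply: lt_trans q1.
(* Covering sets finer than q^-K have n.+2 >= K, which ensures both n.+2 >= n0
   and n - m - l >= n.+2 / 2. *)
pose K := (n0 + 2 * (m + l) + 4)%N.
exists (#|F|%:R ^ (- K%:Z)); first by rewrite exprz_gt0.
move=> d A dK SA; apply: le_ereal_inf_tmp => _ [U [cov Ud] <-].
have [_ hmono _ _] := gh; have h_ge0 r := @gauge_ge0 _ h r gh.
have dU0 i : 0 <= fine (diam (U i)) by rewrite fine_ge0 ?diam_ge0.
apply/lee_addgt0Pr => e e0.
(* Sets of diameter 0 cost nothing: they are given a length so large that their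
   frequency is paid for by the summable error e / 2^(i+1). *)
have lengths i : exists n : nat, [/\ (m + l < n)%N,
    forall x y, U i x -> U i y -> forall j, (j < n)%N -> dig x j = dig y j &
    c / 2 / (n - m - l)%:R <= h (fine (diam (U i))) + e / (2 ^ i.+1)%:R].
  have ei0 : 0 < e / (2 ^ i.+1)%:R by rewrite divr_gt0// ltr0n expn_gt0.
  have [single|[n agree nU]] := diam_agree (Ud i).
    pose b := Num.bound (c / 2 / (e / (2 ^ i.+1)%:R)).
    exists (m + l + b.+1)%N; split; first by lia.
      by move=> x y Ux Uy j _; rewrite (single x y).
    have -> : (m + l + b.+1 - m - l = b.+1)%N by lia.
    have cb : c / 2 / (e / (2 ^ i.+1)%:R) <= b.+1%:R.
      apply/ltW/(lt_le_trans (archi_boundP _)); last by rewrite ler_nat.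
      by rewrite !divr_ge0// ltW.
    rewrite ler_wpDl ?h_ge0// ler_pdivrMr ?ltr0n// [leRHS]mulrC.
    by rewrite -ler_pdivrMr.
  have Kn : (K <= n.+2)%N.
    have : #|F|%:R ^ (- n.+2%:Z) <= #|F|%:R ^ (- K%:Z) :> R.
      apply: le_trans nU (le_trans _ dK).
      by rewrite -lee_fin fineK ?(diam_fin (Ud i)).
    by rewrite ler_eXz2l// lerN2 lez_nat.
  exists n; split=> //; first by lia.
  apply: ler_wpDr; first exact: ltW.
  apply: (@le_trans _ _ (c / n.+2%:R)).
    rewrite -mulrA ler_wpM2l ?(ltW c0)// -invfM lef_pV2 ?posrE; last 2 first.
    - by rewrite -natrM ltr0n; lia.
    - by rewrite ltr0n.
    by rewrite -natrM ler_nat; lia.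
  apply: le_trans (hlow _ _) _; first by lia.
  by apply: hmono nU; rewrite in_itv/= ?andbT// exprz_ge0// ltW.
have [n nP] := choice lengths.
have [M Mcov] := Tpreimage_finite_cover n (subset_trans SA cov).
pose B i (w : m.-tuple F) k := `[< exists2 u, U i u &
  forall j, (j < n i)%N -> dig u j = prefixed (dig Theta) w k j >].
have count : #|{: m.-tuple F}|%:R <= \sum_(i < M) (n i - m - l)%:R^-1 :> R.
  apply: (@separated_cover_count _ _ _ (fun i => n i - m - l)%N B).
  - move=> w k; have [i iM Bi] := Mcov w k.
    by exists i => //; apply/asboolP.
  - by move=> i; have [ni _ _] := nP i; lia.
  - move=> i w k w' k' /asboolP[u Uu uw] /asboolP[v Uv vw].
    have [ni agree _] := nP i; apply: (prefixed_agree Tl); first by lia.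
    by move=> j jn; rewrite -uw// -vw//; apply: agree.
rewrite card_tuple in count.
apply: le_trans (epsilon_trick xpredT _ (ltW e0)); last first.
  by move=> i; rewrite lee_fin h_ge0.
apply: le_trans (nneseries_lim_ge M _); last first.
  by move=> i _ _; rewrite -EFinD lee_fin addr_ge0 ?h_ge0// divr_ge0// ltW.
rewrite big_mkord; under eq_bigr do rewrite -EFinD.
rewrite sumEFin lee_fin.
apply: (@le_trans _ _ (\sum_(i < M) c / 2 / (n i - m - l)%:R)).
  by rewrite -mulr_sumr -natrX ler_wpM2l ?divr_ge0 ?(ltW c0).
by apply: ler_sum => i _; have [_ _] := nP i.
Qed.

(** * Hausdorff measures and logarithmic gauges *)

Lemma Hdelta_antitone (R : realType) (X : metricType R) (h : R -> R)
    (E : set X) (d d' : R) :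
  d <= d' -> (Hdelta h E d' <= Hdelta h E d)%E.
Proof.
move=> dd'; apply: le_ereal_inf => _ [U [cov Ud] <-]; exists U => //.
by split=> // i; apply: le_trans (Ud i) _; rewrite lee_fin.
Qed.

(** The contents increase as the scale decreases to 0, so the limit that defines
    the measure exists. *)
Lemma Hmeasure_ge (R : realType) (X : metricType R) (h : R -> R) (E : set X)
    (a : \bar R) (d0 : R) : 0 < d0 ->
  (forall d, d <= d0 -> (a <= Hdelta h E d)%E) -> (a <= Hmeasure h E)%E.
Proof.
move=> d00 ad; apply: lime_ge.
  apply: nonincreasing_at_right_is_cvge; near=> x.
  by move=> d d' _ _; exact: Hdelta_antitone.
by near=> d; apply: ad; near: d; exact: nbhs_right_le.
Unshelve. all: by end_near. Qed.

(** Singletons have diameter 0, and h 0 = 0. *)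
Lemma Hmeasure_countable (R : realType) (X : metricType R) (h : R -> R)
    (E : set X) : h 0 = 0 -> (forall r, 0 <= r -> 0 <= h r) -> countable E ->
  Hmeasure h E = 0%E.
Proof.
move=> h0 h_ge0 /pcard_leTP[g].
have H0 d : 0 <= d -> Hdelta h E d = 0%E.
  move=> d0; apply/eqP; rewrite eq_le; apply/andP; split; last first.
    apply: le_ereal_inf_tmp => _ [U [_ Ud] <-]; apply: nneseries_ge0 => i _ _.
    by rewrite lee_fin h_ge0// fine_ge0// diam_ge0.
  have diam0 i : diam [set x | E x /\ g x = i] = 0%E.
    apply/eqP; rewrite eq_le diam_ge0 andbT.
    apply: ge_ereal_sup => _ [[x [Ex gx] [y [Ey gy] <-]]|->//].
    by rewrite (@inj _ _ _ g x y) ?inE ?mdistxx// gx gy.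
  apply: ereal_inf_lbound; exists (fun i => [set x | E x /\ g x = i]).
    split=> [x Ex|i]; last by rewrite diam0 lee_fin.
    by exists (g x).
  by apply: eseries0 => i _ _; rewrite diam0/= h0.
apply: lim_near_cst => //; near=> d; apply: H0.
by near: d; exact: nbhs_right_ge.
Unshelve. all: by end_near. Qed.

(** With L = n log q >= 1, one has h (q^-n) = 1 / L^s >= 1 / L when s <= 1. *)
Lemma log_gauge_expz (R : realType) (F : finFieldType) (s : R) (h : R -> R) :
  0 < s <= 1 -> log_gauge s h ->
  exists c n0, 0 < c /\
    forall n, (n0 <= n)%N -> c / n%:R <= h (#|F|%:R ^ (- n%:Z)).
Proof.
move=> /andP[s0 s1] [_ hE]; have q1 := card_gt1R R F.
have q0 : 0 < #|F|%:R :> R by apply: lt_trans q1.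
have [n0 nP] := small_exprzN F (expR_gt0 (-1 : R)).
exists (ln #|F|%:R)^-1, n0; split; first by rewrite invr_gt0 ln_gt0.
move=> n /nP small; have r0 : 0 < #|F|%:R ^ (- n%:Z) :> R by rewrite exprz_gt0.
rewrite hE ?r0//.
have L1 : 1 <= ln (#|F|%:R ^ (- n%:Z))^-1 :> R.
  by rewrite lnV ?posrE// lerNr -[leRHS]expRK ler_ln ?posrE ?expR_gt0// ltW.
have L0 := lt_le_trans ltr01 L1.
apply: (@le_trans _ _ (ln (#|F|%:R ^ (- n%:Z))^-1)^-1).
  by rewrite -exprnN invrK lnXn// -invfM mulr_natr.
by rewrite lef_pV2 ?posrE ?powR_gt0// -[leRHS]powRr1 ?(ltW L0)// ler_powR.
Qed.

(** * Cardinality of the continuum *)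

Lemma card_le_inj (T U : Type) (A : set T) (B : set U) (f : T -> U) :
  {in A &, injective f} -> (forall x, A x -> B (f x)) -> (A #<= B)%card.
Proof.
move=> finj fAB; rewrite -(card_le_eql (inj_card_eq finj)).
by apply: subset_card_le => _ [x /fAB ? <-].
Qed.

Lemma first_difference (T : eqType) (b b' : nat -> T) : b <> b' ->
  exists k, b k != b' k /\ forall i, (i < k)%N -> b i = b' i.
Proof.
move=> bb'; have ex : exists k, b k != b' k.
  apply: contrapT => /forallNP same; apply: bb'; apply/funext => k.
  by apply/eqP/negPn/negP/same.
exists (ex_minn ex); case: ex_minnP => k bk kmin; split=> // i ik.
by apply/eqP/negPn/negP => /kmin; rewrite leqNgt ik.
Qed.

(** A real number is determined by the set of rationals below it. *)
Lemma card_real_le_bits (R : realType) :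
  ([set: R] #<= [set: nat -> bool])%card.
Proof.
apply: (@card_le_inj _ _ _ _
  (fun (x : R) n => if unpickle n is Some q then (ratr q < x) else false)) => //.
suff lt (x y : R) : x < y ->
    (fun n => if unpickle n is Some q then ratr q < x else false)
    <> (fun n => if unpickle n is Some q then ratr q < y else false).
  move=> x y _ _ /= xy.
  by case: (ltgtP x y) => [/lt/(_ xy)|/lt/(_ (esym xy))|].
move=> xy; have [q] := rat_in_itvoo xy; rewrite in_itv/= => /andP[xq qy].
move=> /(congr1 (fun f => f (pickle q))); cbv beta; rewrite pickleK qy => qx.
by rewrite (lt_gtF xq) in qx.
Qed.

(** Base 3 with digits 0 and 1, so that distinct bit sequences have distinct
    sums. *)
Definition ternary_sum (R : realType) (b : nat -> bool) (n : nat) : R :=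
  \sum_(i < n) (b i)%:R * 3 ^- i.

Lemma ternary_sum_le (R : realType) (b : nat -> bool) (k n : nat) :
  ternary_sum R b n <= ternary_sum R b k + 3 / 2 * 3 ^- k.
Proof.
have pos i : 0 < 3 ^- i :> R by rewrite invr_gt0 exprn_gt0.
have [kn|nk] := leqP k n; last first.
  rewrite -(subnKC (ltnW nk)) /ternary_sum big_split_ord/= -addrA lerDl.
  by rewrite addr_ge0 ?mulr_ge0 ?sumr_ge0// => [i _|]; rewrite ?mulr_ge0// ltW.
suff : ternary_sum R b n + 3 / 2 * 3 ^- n <= ternary_sum R b k + 3 / 2 * 3 ^- k.
  by apply: le_trans; rewrite lerDl mulr_ge0// ltW.
rewrite -(subnKC kn); elim: (n - k)%N => [|m IH]; first by rewrite addn0.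
apply: le_trans IH; rewrite addnS /ternary_sum big_ord_recr/= -addrA lerD2l.
rewrite exprS invfM; have := pos (k + m)%N; case: (b _) => /=; nra.
Qed.

Lemma card_bits_le_real (R : realType) :
  ([set: nat -> bool] #<= [set: R])%card.
Proof.
pose val (b : nat -> bool) : R := sup (range (ternary_sum R b)).
have le_val b n : ternary_sum R b n <= val b.
  apply: ub_le_sup; last by exists n.
  exists (ternary_sum R b 0 + 3 / 2 * 3 ^- 0) => _ [i _ <-].
  exact: ternary_sum_le.
have val_le b k : val b <= ternary_sum R b k + 3 / 2 * 3 ^- k.
  apply: ge_sup; first by exists (ternary_sum R b 0), 0%N.
  by move=> _ [i _ <-]; exact: ternary_sum_le.
have lt (b b' : nat -> bool) k : (forall i, (i < k)%N -> b i = b' i) ->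
    b k -> ~~ b' k -> val b' < val b.
  move=> eq bk b'k; apply: le_lt_trans (val_le b' k.+1) _.
  apply: lt_le_trans (le_val b k.+1).
  rewrite /ternary_sum !big_ord_recr/= bk (negbTE b'k) mul0r addr0.
  rewrite (eq_bigr (fun i : 'I_k => (b i)%:R * 3 ^- i)) => [|i _].
    2: by rewrite eq.
  rewrite ltrD2l exprS invfM mul1r.
  have : 0 < 3 ^- k :> R by rewrite invr_gt0 exprn_gt0.
  set t := (3 ^+ k)^-1; move=> t0. lra.
apply: (@card_le_inj _ _ _ _ val) => // b b' _ _ bb'; apply: contrapT.
move=> /first_difference[k [bk eq]].
have := lt b' b k (fun i ik => esym (eq i ik)); have := lt b b' k eq.
rewrite bb' ltxx.
case: (b k) (b' k) bk => -[]//= _ l1 l2; first by have := l1 isT isT.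
by have := l2 isT isT.
Qed.

Lemma card_words_le_bits (T : countType) :
  ([set: nat -> T] #<= [set: nat -> bool])%card.
Proof.
apply: (@card_le_inj _ _ _ _ (fun c n =>
  if unpickle n is Some ia then c ia.1 == ia.2 else false)) => // c c' _ _ cc'.
apply/funext => i; have := congr1 (fun f => f (pickle (i, c i))) cc'.
by rewrite /= pickleK/= eqxx => /esym/eqP.
Qed.

(** Cantor-Bendixson: the condensation points C of A form a set without isolated
    points, and all but countably many points of A are in C.  Starting from a
    point of C, one can therefore choose again and again between staying there
    and moving to a nearby second point of C, which gives a binary tree of
    cylinders; A contains the limits along its branches. *)
Lemma card_bits_le_uncountable_closed (T : countType) (A : set (nat -> T)) :
  (forall z, (forall n, exists2 x, A x & forall j, (j < n)%N -> x j = z j) ->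
     A z) ->
  ~ countable A -> ([set: nat -> bool] #<= A)%card.
Proof.
move=> Acl Anc.
pose cyl (x : nat -> T) n := [set y : nat -> T | forall j, (j < n)%N -> y j = x j].
pose C := A `&` [set x | forall n, ~ countable (A `&` cyl x n)].
(* A \ C is covered by the countable traces of A on cylinders, and there are
   only countably many cylinders. *)
have AC : countable (A `\` C).
  pose W (w : seq T) := A `&` [set y | mkseq y (size w) = w].
  apply: (@sub_countable _ _ _ (\bigcup_(w in [set w | countable (W w)]) W w)).
    apply: subset_card_le => x [Ax /not_andP[//|/existsNP[n /contrapT nx]]].
    exists (mkseq x n); last by split=> //=; rewrite size_mkseq.
    apply: sub_countable nx; apply: subset_card_le => y [Ay /=].
    rewrite size_mkseq => yx; split=> // j jn.
    by rewrite -(nth_mkseq (x 0) y jn) yx nth_mkseq.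
  by apply: bigcup_countable => [|w //]; exact: countableP.
have ncC x n : C x -> exists p : (nat -> T) * nat,
    [/\ C p.1, cyl x n p.1, (n <= p.2)%N & p.1 p.2 != x p.2].
  move=> [Ax xnc]; apply: contrapT => /forallNP none; apply: (xnc n).
  apply: (@sub_countable _ _ _ 
      (\bigcup_(b in [set: bool]) if b then [set x] else A `\` C)); last first.
    by apply: bigcup_countable => // -[] _ //; exact: countable1.
  apply: subset_card_le => y [Ay yx].
  have [->|] := pselect (y = x); first by exists true.
  move=> /first_difference[j [yj jx]]; exists false => //; split=> // Cy.
  apply: (none (y, j)); split=> //=; rewrite leqNgt; apply: contraNN yj => jn.
  by rewrite yx.
have [x0 Cx0] : C !=set0.
  apply/set0P/eqP => C0; apply: Anc; apply: sub_countable AC.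
  by rewrite C0 setD0; exact: card_lexx.
have choose (p : (nat -> T) * nat) : exists p' : (nat -> T) * nat, C p.1 ->
    [/\ C p'.1, cyl p.1 p.2 p'.1, (p.2 <= p'.2)%N & p'.1 p'.2 != p.1 p'.2].
  have [Cp|nCp] := pselect (C p.1); last by exists p.
  by have [p' ?] := ncC _ p.2 Cp; exists p'.
have {choose}[s sP] := choice choose.
(* A state (x, n) stands for the cylinder of the first n digits of x.  A step
   chooses between x and a second point with the same n digits, and makes n
   large enough to separate the two. *)
pose st b := fix st k := if k is k.+1 then
  (if b k then (s (st k)).1 else (st k).1, (s (st k)).2.+1) else (x0, 0%N).
have Cst b k : C (st b k).1.
  by elim: k => //= k IH; case: (b k) => //; have [] := sP _ IH.
have st_step b k : cyl (st b k).1 (st b k).2 (st b k.+1).1 /\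
    ((st b k).2 < (st b k.+1).2)%N.
  have [_ ? ? _] := sP _ (Cst b k); split=> //=.
  by case: (b k) => // j.
have st_ge b k : (k <= (st b k).2)%N.
  by elim: k => // k IH; apply: leq_ltn_trans IH (st_step b k).2.
have st_mono b k m : cyl (st b k).1 (st b k).2 (st b (k + m)%N).1 /\
    ((st b k).2 <= (st b (k + m)%N).2)%N.
  elim: m => [|m [IH1 IH2]]; first by rewrite addn0.
  rewrite addnS; have [S1 S2] := st_step b (k + m)%N; split.
    by move=> j jk; rewrite S1 ?IH1//; apply: leq_trans jk IH2.
  exact: leq_trans IH2 (ltnW S2).
pose lim b j := (st b j.+1).1 j.
have limP b k j : (j < (st b k).2)%N -> lim b j = (st b k).1 j.
  move=> jk; have [kj|jk'] := leqP k j.+1.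
    by have := (st_mono b k (j.+1 - k)%N).1 j jk; rewrite subnKC.
  have := (st_mono b j.+1 (k - j.+1)%N).1 j (st_ge _ _).
  by rewrite subnKC// ltnW.
apply: (@card_le_inj _ _ _ _ lim) => [b b' _ _ bb'|b _]; last first.
  apply: Acl => n; exists (st b n).1; first by have [] := Cst b n.
  by move=> j jn; rewrite (@limP b n)//; exact: leq_trans jn (st_ge b n).
apply: contrapT => /first_difference[k [bk eq]].
have stk : st b k = st b' k.
  elim: k {bk} eq => //= k IH eq; rewrite IH ?eq// => i ik.
  by apply: eq; exact: ltnW.
have [_ _ _] := sP _ (Cst b k); set j := (s _).2.
have : lim b j = lim b' j by rewrite bb'.
rewrite !(limP _ k.+1)/= -?stk ?ltnSn//.
by case: (b k) (b' k) bk => -[]//= _ ->; rewrite eqxx.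
Qed.

(** * Measure, dimension and cardinality of E_q^(t) *)

(** At level m the scale below which the content bound holds depends on m, but
    the bound itself survives in the limit with a constant independent of m. *)
Lemma Hmeasure_Tpreimage_ge (R : realType) (F : finFieldType) (s : R)
    (h : R -> R) (Theta : Iq R F) : 0 < s <= 1 -> log_gauge s h -> Eqt Theta ->
  exists2 c : R, 0 < c & forall m A, Tpreimage m Theta `<=` A ->
    ((c * #|F|%:R ^+ m)%:E <= Hmeasure h A)%E.
Proof.
move=> s01 hs ET; have [c [n0 [c0 hlow]]] := log_gauge_expz F s01 hs.
exists (c / 2) => [|m A SA]; first by rewrite divr_gt0.
have [d0 d00 H] := Hdelta_Tpreimage_ge m hs.1 c0 hlow ET.
by apply: (Hmeasure_ge d00) => d dd0; exact: H.
Qed.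

Lemma Hmeasure_Korbit_gt0 (R : realType) (F : finFieldType) (h : R -> R)
    (Theta : Iq R F) :
  log_gauge 1 h -> Eqt Theta -> (0 < Hmeasure h (Korbit Theta))%E.
Proof.
move=> h1 ET; have s01 : 0 < (1 : R) <= 1 by rewrite ltr01 lexx.
have [c c0 H] := Hmeasure_Tpreimage_ge s01 h1 ET.
by apply: lt_le_trans (H 0%N _ (@subset_refl _ _)); rewrite lte_fin mulr1.
Qed.

(** E_q^(t) contains T^-m K(Theta) for every m. *)
Lemma Hmeasure_Eqt (R : realType) (F : finFieldType) (s : R) (h : R -> R) :
  0 < s <= 1 -> log_gauge s h -> @Eqt R F !=set0 ->
  Hmeasure h (@Eqt R F) = +oo%E.
Proof.
move=> s01 hs [x Ex]; have [c c0 H] := Hmeasure_Tpreimage_ge s01 hs Ex.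
apply/eqyP => r r0.
pose m := Num.bound (r / c).
apply: le_trans (H m _ (Tpreimage_Eqt Ex)).
rewrite lee_fin mulrC -ler_pdivrMr//.
apply/ltW/(lt_le_trans (archi_boundP (divr_ge0 (ltW r0) (ltW c0)))).
rewrite -natrX ler_nat -/m.
exact/ltnW/ltn_expl/card_finNzRing_gt1.
Qed.

Lemma Korbit_card (R : realType) (F : finFieldType) (h : R -> R)
    (Theta : Iq R F) : log_gauge 1 h -> Eqt Theta ->
  ([set: nat -> bool] #<= Korbit Theta)%card.
Proof.
move=> h1 ET.
pose A := [set c | Korbit Theta (of_dig R c)].
apply: (@card_le_trans _ _ _ A).
  apply: card_bits_le_uncountable_closed => [z zA|cA].
    apply/KorbitP => n; have [x /KorbitP Kx xz] := zA n.
    have [k kP] := Kx n; exists k => i ni.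
    by rewrite of_digK -xz// -kP// of_digK.
  have cK : countable (Korbit Theta).
    apply: sub_countable cA; apply: (@card_le_inj _ _ _ _ (@dig R F)).
      by move=> x y _ _ xy; apply: dig_inj => i; rewrite xy.
    by move=> x Kx; rewrite /A/= digK.
  have := Hmeasure_Korbit_gt0 h1 ET.
  rewrite (Hmeasure_countable _ _ cK) ?ltxx//; first by case: h1 => -[].
  by move=> r; exact: gauge_ge0 h1.1.
apply: (@card_le_inj _ _ _ _ (@of_dig R F)) => // x y _ _.
by move=> /(congr1 (@dig R F)); rewrite !of_digK.
Qed.

Lemma Eqt_card (R : realType) (F : finFieldType) (h : R -> R) :
  log_gauge 1 h -> @Eqt R F !=set0 -> (@Eqt R F #= [set: R])%card.
Proof.
move=> h1 [x Ex]; apply/card_eqPle; split.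
  apply: (@card_le_trans _ _ _ [set: nat -> F]).
    apply: (@card_le_inj _ _ _ _ (@dig R F)) => // y z _ _ yz.
    by apply: dig_inj => i; rewrite yz.
  exact: card_le_trans (card_words_le_bits F) (card_bits_le_real R).
apply: card_le_trans (card_real_le_bits R) _.
apply: card_le_trans (Korbit_card h1 Ex) _.
exact: subset_card_le (@Tpreimage_Eqt _ _ 0 _ Ex).
Qed.

Theorem theorem3p1 (R : realType) (F : finFieldType) (h : R -> R -> R)
  (h_log : forall s : R, 0 < s -> log_gauge s (h s)) :
  [/\ forall Theta : Iq R F, Eqt Theta ->
        (0 < Hmeasure (h 1%R) (Korbit Theta))%E,
      @Eqt R F !=set0 -> Hmeasure (h 1) (@Eqt R F) = +oo%E &
      @Eqt R F !=set0 ->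
        (1 <= dim_log h (@Eqt R F))%E /\ (@Eqt R F #= [set: R])%card].
Proof.
have h1 := h_log 1 ltr01; split.
- by move=> Theta; exact: Hmeasure_Korbit_gt0.
- apply: (@Hmeasure_Eqt R F 1) => //; by rewrite ltr01 lexx.
- move=> E0; split; last exact: Eqt_card h1 E0.
  apply: le_ereal_inf_tmp => _ [s [s0 Hs0] <-]; rewrite lee_fin leNgt.
  apply/negP => s1; have := Hmeasure_Eqt _ (h_log s s0) E0.
  by rewrite Hs0 s0 ltW// => /(_ isT).
Qed.
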